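(* Let $n\ge 1$, let $Q\in\mathbb{R}^{n\times n}$, and let $\mathsf{P}$ be the set of $n\times n$ permutation matrices. Let $\boldsymbol{X}$ be a random vector uniformly distributed on the unit hypersphere $S^{n-1}=\{\boldsymbol{x}\in\mathbb{R}^n:\|\boldsymbol{x}\|=1\}$. Then $$\arg\min_{P\in\mathsf{P}}\|Q-P\|_{\rm F}^2=\arg\min_{P\in\mathsf{P}}E\left(\|Q\boldsymbol{X}-P\boldsymbol{X}\|_{\rm F}^2\right).$$
   Context: $\|A\|_{\rm F}=[\mathrm{tr}(AA^H)]^{1/2}$ is the Frobenius norm; on column vectors it is the Euclidean norm. $\mathsf{P}=\{P\in\mathbb{R}^{n\times n}:P\mathbf{1}=P^T\mathbf{1}=\mathbf{1},\ P_{ij}\in\{0,1\}\}$, where $\mathbf{1}$ is the all-ones vector. $\arg\min$ denotes the set of all minimisers, so the claim is an equality of subsets of $\mathsf{P}$. $E$ denotes expectation. *)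

(* Defs.v *)
(* MathComp-Analysis: the real field is an arbitrary R : realType. *)
From HB Require Import structures.
From mathcomp Require Export all_boot all_order all_algebra.
From mathcomp Require Export all_classical all_reals all_analysis.
Export Order.TTheory GRing.Theory Num.Theory.
Export numFieldNormedType.Exports.

Set Implicit Arguments.
Unset Strict Implicit.
Unset Printing Implicit Defensive.

Local Open Scope classical_set_scope.
Local Open Scope ring_scope.

Definition argmin {d : Order.disp_t} {V : porderType d} {T : Type}
    (D : set T) (f : T -> V) : set T :=
  [set x | D x /\ forall y, D y -> (f x <= f y)%O].

(* On column vectors this is the Euclidean norm; MathComp-Analysis' `|A| on
   matrices is the sup norm instead.  Entries are real, so A^H is A^T. *)
Definition frobenius {R : realType} {m n : nat} (A : 'M[R]_(m, n)) : R :=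
  Num.sqrt (\tr (A *m A^T)).

Definition perm_matrices (R : realType) (n : nat) : set 'M[R]_n :=
  [set P | [/\ P *m const_mx 1 = const_mx 1 :> 'cV[R]_n,
               P^T *m const_mx 1 = const_mx 1 :> 'cV[R]_n &
               forall i j, P i j = 0 \/ P i j = 1]].
Arguments perm_matrices : clear implicits.

Definition unit_sphere (R : realType) (n : nat) : set 'cV[R]_n :=
  [set x | frobenius x = 1].
Arguments unit_sphere : clear implicits.

(* The sup norm and the Euclidean norm have the same open sets, so these are
   the usual Borel sets of R^n. *)
Definition borel_cV (R : realType) (n : nat) :=
  g_sigma_algebraType (@open 'cV[R]_n).

Section hausdorff.
Context {R : realType} {n : nat}.
Implicit Types A : set 'cV[R]_n.
Local Open Scope ereal_scope.

(* Euclidean diameter; -oo on the empty set. *)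
Definition diameter A : \bar R :=
  ereal_sup [set (frobenius (x - y))%:E | x in A & y in A].

(* The empty set is treated apart so that it has size 0 even for s = 0, where
   a singleton has size 0 ^+ 0 = 1. *)
Definition diameter_pow (s : nat) A : \bar R :=
  if A == set0 then 0 else diameter A ^+ s.

Definition hausdorff_content (s : nat) (delta : R) A : \bar R :=
  ereal_inf [set \sum_(0 <= k <oo) diameter_pow s (U k) |
    U in [set U : nat -> set 'cV[R]_n |
            A `<=` \bigcup_k U k /\ forall k, diameter (U k) <= delta%:E]].

(* s-dimensional Hausdorff (outer) measure, up to the usual multiplicative
   constant depending only on s.  The content is nonincreasing in delta, so the
   supremum is the limit as delta tends to 0. *)
Definition hausdorff_measure (s : nat) A : \bar R :=
  ereal_sup [set hausdorff_content s delta A | delta in [set e : R | (0 < e)%R]].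

End hausdorff.

(* The law of X is the normalised surface measure of the sphere, i.e. its
   (n-1)-dimensional Hausdorff measure (for n = 1, counting measure on
   {-1, 1}).  The normalisation makes the constant omitted in
   hausdorff_measure irrelevant. *)
Definition uniform_on_sphere (R : realType) (n : nat) (d : measure_display)
    (Omega : measurableType d) (Pr : probability Omega R)
    (X : {RV Pr >-> borel_cV R n}) : Prop :=
  forall A : set (borel_cV R n), measurable A ->
    (distribution Pr X A =
     hausdorff_measure n.-1 (A `&` unit_sphere R n) /
     hausdorff_measure n.-1 (unit_sphere R n))%E.

(* Main.v *)
(* The law A |-> H(A `&` S) / H(S) of X has total mass H(S) / H(S), so X lies on
   the sphere S almost surely and the value of H(S) is never needed.  Hausdorff
   measure is invariant under orthogonal maps, hence so is the law of X.
   Reflecting one coordinate gives E[X_i X_j] = 0 for i <> j, transposing two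
   coordinates makes all E[X_i ^ 2] equal, and they add up to E[|X| ^ 2] = 1.
   Therefore E[|A X| ^ 2] = |A|_F ^ 2 / n for every matrix A, and for A = Q - P
   the two objectives are proportional. *)
Require Import Defs.
From mathcomp Require Import perm ring lra measurable_realfun.

Set Implicit Arguments.
Unset Strict Implicit.
Unset Printing Implicit Defensive.

Local Open Scope classical_set_scope.
Local Open Scope ring_scope.

(** * Frobenius norm: sums of squares and orthogonal invariance *)

Section frobenius_norm.
Context {R : realType}.

Lemma frobenius_sqr m n (A : 'M[R]_(m, n)) :
  frobenius A ^+ 2 = \sum_i \sum_j A i j ^+ 2.
Proof.
have E : \tr (A *m A^T) = \sum_i \sum_j A i j ^+ 2.
  apply: eq_bigr => i _; rewrite mxE; apply: eq_bigr => j _.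
  by rewrite mxE expr2.
rewrite /frobenius sqr_sqrtr E//.
by apply: sumr_ge0 => i _; apply: sumr_ge0 => j _; exact: sqr_ge0.
Qed.

Lemma frobenius_sqr_cV n (x : 'cV[R]_n) :
  frobenius x ^+ 2 = \sum_i x i 0 ^+ 2.
Proof. by rewrite frobenius_sqr; apply: eq_bigr => i _; rewrite big_ord1. Qed.

Lemma frobenius_orthogonal n (O : 'M[R]_n) (x : 'cV[R]_n) :
  O^T *m O = 1%:M -> frobenius (O *m x) = frobenius x.
Proof.
(* Cyclicity of the trace turns tr(x x^T) into tr(x^T x), where O^T O appears in the middle and
   cancels. *)
move=> OO; rewrite /frobenius mxtrace_mulC [in RHS]mxtrace_mulC.
by rewrite trmx_mul -mulmxA (mulmxA O^T) OO mul1mx.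
Qed.

End frobenius_norm.

(** * Orthogonal invariance of Hausdorff measure *)

Section hausdorff_orthogonal.
Context {R : realType} {n : nat}.
Implicit Types (A : set 'cV[R]_n) (O : 'M[R]_n).

(** The inverse of O is O^T. Laws are transported by preimages and covers by images; this passes
    from one to the other. *)
Lemma preimage_orthogonal O A : O^T *m O = 1%:M ->
  mulmx O @^-1` A = mulmx O^T @` A.
Proof.
move=> OO; apply/seteqP; split => [x Ax|_ [x Ax <-]].
  by exists (O *m x) => //; rewrite mulmxA OO mul1mx.
by rewrite /= mulmxA (mulmx1C OO) mul1mx.
Qed.

Lemma diameter_orthogonal O A : O^T *m O = 1%:M ->
  diameter (mulmx O @` A) = diameter A.
Proof.
move=> OO; congr (ereal_sup _); apply/seteqP; split.
  move=> _ [_ [x Ax <-]] [_ [y Ay <-]] <-.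
  by exists x => //; exists y => //; rewrite -mulmxBr frobenius_orthogonal.
move=> _ [x Ax] [y Ay] <-.
exists (O *m x); first by exists x.
exists (O *m y); first by exists y.
by rewrite -mulmxBr frobenius_orthogonal.
Qed.

Lemma diameter_pow_orthogonal s O A : O^T *m O = 1%:M ->
  diameter_pow s (mulmx O @` A) = diameter_pow s A.
Proof.
move=> OO; rewrite /diameter_pow diameter_orthogonal//.
(* [diameter_pow] treats the empty set apart, so emptiness must be preserved as well as the
   diameter. *)
have [->|A0] := eqVneq A set0; first by rewrite image_set0 eqxx.
case: ifPn => [/eqP A'0|//].
by move/image_set0_set0: A'0 A0 => ->; rewrite eqxx.
Qed.

(** Every admissible cover of A is carried by O to a cover of the image with the same diameters,
    hence the same cost. *)
Lemma hausdorff_content_orthogonal_le s delta O A : O^T *m O = 1%:M ->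
  (hausdorff_content s delta (mulmx O @` A) <= hausdorff_content s delta A)%E.
Proof.
move=> OO; apply: ereal_inf_le_tmp => _ [U [AU dU] <-].
exists (fun k => mulmx O @` U k); last first.
  by apply: eq_eseriesr => k _; rewrite diameter_pow_orthogonal.
split=> [_ [x /AU[k _ Ukx] <-]|k]; last by rewrite diameter_orthogonal.
by exists k => //; exists x.
Qed.

Lemma hausdorff_content_orthogonal s delta O A : O^T *m O = 1%:M ->
  hausdorff_content s delta (mulmx O @` A) = hausdorff_content s delta A.
Proof.
move=> OO; apply/eqP; rewrite eq_le hausdorff_content_orthogonal_le//=.
(* The reverse inequality is the previous lemma for the inverse O^T, applied to the image of A. *)
have {1}-> : A = mulmx O^T @` (mulmx O @` A).
  rewrite -preimage_orthogonal//; apply/seteqP; split=> [x Ax|x [y Ay]].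
    by exists x.
  by move=> /(congr1 (mulmx O^T)); rewrite !mulmxA OO !mul1mx => <-.
by apply: hausdorff_content_orthogonal_le; rewrite trmxK (mulmx1C OO).
Qed.

Lemma hausdorff_measure_orthogonal s O A : O^T *m O = 1%:M ->
  hausdorff_measure s (mulmx O @` A) = hausdorff_measure s A.
Proof.
move=> OO; congr (ereal_sup _); apply: eq_imagel => delta _.
exact: hausdorff_content_orthogonal.
Qed.

End hausdorff_orthogonal.

(** * Borel measurability of linear maps, coordinates and the sphere *)

Section borel_vectors.
Context {R : realType} {n : nat}.

Lemma open_borel (A : set 'cV[R]_n) :
  open A -> measurable (A : set (borel_cV R n)).
Proof. exact: sub_sigma_algebra. Qed.

Lemma mulmx_continuous m (O : 'M[R]_(m, n)) :
  continuous (mulmx O : 'cV[R]_n -> 'cV[R]_m).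
Proof.
have coordO i j : continuous (fun y : 'cV[R]_n => (O *m y) i j).
  under eq_fun do rewrite mxE.
  apply: continuous_big => [|k _ y]; first exact: add_continuous.
  exact: (@cvgMl_tmp R _ (nbhs y) (nbhs_filter y) _ _ _
    (@coord_continuous R n 1 k j y)).
(* A neighbourhood of a matrix contains a product of neighbourhoods [P i j] of its entries, so
   finitely many entrywise conditions suffice. *)
move=> x A [P Px PA].
suff : nbhs x (fun y : 'cV[R]_n => forall i j, P i j ((O *m y) i j)).
  by apply: filterS => y Py; exact: PA.
apply: (@filter_forall _ _ (fun i (y : 'cV[R]_n) =>
  forall j, P i j ((O *m y) i j)) _ (nbhs_filter x)) => i.
apply: (@filter_forall _ _ (fun j (y : 'cV[R]_n) => P i j ((O *m y) i j)) _
  (nbhs_filter x)) => j.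
exact: (coordO i j x (P i j) (Px i j)).
Qed.

Lemma mulmx_measurable (O : 'M[R]_n) :
  measurable_fun [set: borel_cV R n] (mulmx O : borel_cV R n -> borel_cV R n).
Proof.
apply: (@measurability _ _ (borel_cV R n) (borel_cV R n) _ _ (@open 'cV[R]_n)).
  by [].
move=> _ [A oA <-]; rewrite setTI; apply: open_borel.
by move/continuousP: (@mulmx_continuous _ O); apply.
Qed.

Lemma coord_measurable i :
  measurable_fun [set: borel_cV R n]
    (fun x : borel_cV R n => (x : 'cV[R]_n) i 0 : R).
Proof.
apply: (measurability _ (RGenOpens.measurableE R)).
move=> _ [_ [a [b ->] <-]]; rewrite setTI; apply: open_borel.
move/continuousP: (@coord_continuous R n 1 i 0); apply.
exact: interval_open.
Qed.

(** A polynomial in the coordinates. It serves for the integrand of the expectation and, with A the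
    identity, for the sphere. *)
Lemma frobenius_measurable m (A : 'M[R]_(m, n)) :
  measurable_fun [set: borel_cV R n]
    (fun x : borel_cV R n => frobenius (A *m (x : 'cV[R]_n)) ^+ 2 : R).
Proof.
rewrite (_ : (fun _ => _) = fun x : borel_cV R n =>
    \sum_i (\sum_k A i k * (x : 'cV[R]_n) k 0) ^+ 2); last first.
  apply/funext => x; rewrite frobenius_sqr_cV.
  by apply: eq_bigr => i _; rewrite mxE.
apply: measurable_sum => i; apply: measurable_funX.
apply: measurable_sum => k; apply: measurable_funM; first exact: measurable_cst.
exact: coord_measurable.
Qed.

Lemma unit_sphereP (x : 'cV[R]_n) :
  unit_sphere R n x <-> \sum_i x i 0 ^+ 2 = 1.
Proof.
rewrite -frobenius_sqr_cV; split=> [->|/eqP]; first by rewrite expr1n.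
by rewrite sqrp_eq1 ?sqrtr_ge0// => /eqP.
Qed.

Lemma unit_sphere_measurable :
  measurable (unit_sphere R n : set (borel_cV R n)).
Proof.
rewrite (_ : unit_sphere R n = [set: borel_cV R n] `&`
    (fun x : borel_cV R n => frobenius (1%:M *m (x : 'cV[R]_n)) ^+ 2 : R)
    @^-1` [set 1]).
  by apply: frobenius_measurable.
rewrite setTI; apply/seteqP.
by split=> x; rewrite unit_sphereP/= mul1mx frobenius_sqr_cV.
Qed.

Lemma unit_sphere_orthogonal (O : 'M[R]_n) : O^T *m O = 1%:M ->
  mulmx O @^-1` unit_sphere R n = unit_sphere R n.
Proof.
move=> OO; apply/seteqP.
by split => x; rewrite /unit_sphere/= frobenius_orthogonal.
Qed.

Lemma unit_sphere_coord_le1 (x : 'cV[R]_n) i :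
  unit_sphere R n x -> `|x i 0| <= 1.
Proof.
rewrite unit_sphereP (bigD1 i)//= => x1.
rewrite -[leRHS](@ger0_norm R 1)// -ler_sqr ?nnegrE ?normr_ge0//.
rewrite !real_normK ?num_real// expr1n -x1 lerDl.
by apply: sumr_ge0 => j _; exact: sqr_ge0.
Qed.

End borel_vectors.

(** * Second moments of the uniform law *)

Section uniform_sphere.
Context {R : realType} {n : nat} {d : measure_display}
  {Omega : measurableType d} {Pr : probability Omega R}
  {X : {RV Pr >-> borel_cV R n}} (hX : uniform_on_sphere X).

Notation S := (unit_sphere R n : set (borel_cV R n)).
Notation mu := (distribution Pr X).

Lemma distribution_sphere : mu S = 1%E.
Proof.
rewrite -(@probability_setT _ _ _ mu) [LHS]hX; last first.
  exact: unit_sphere_measurable.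
by rewrite [RHS]hX// setIid setTI.
Qed.

Lemma distribution_sphereC : mu (~` S) = 0%E.
Proof.
rewrite probability_setC; last exact: unit_sphere_measurable.
by rewrite [X in (_ - X)%E]distribution_sphere subee.
Qed.

Lemma distribution_orthogonal (O : 'M[R]_n) (B : set (borel_cV R n)) :
  O^T *m O = 1%:M -> measurable B -> mu (mulmx O @^-1` B) = mu B.
Proof.
move=> OO mB.
have mOB : measurable (mulmx O @^-1` B : set (borel_cV R n)).
  by rewrite -[X in measurable X]setTI; exact: mulmx_measurable.
(* In the left numerator the sphere is replaced by its own preimage, so that the set measured there
   is the preimage of B intersected with the sphere. *)
rewrite !hX// -{1}(unit_sphere_orthogonal OO) -preimage_setI.
rewrite preimage_orthogonal// hausdorff_measure_orthogonal//.
by rewrite trmxK (mulmx1C OO).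
Qed.

(** Change of variables: the pushforward of [mu] under O is [mu] itself, and O preserves the domain
    [S]. *)
Lemma integral_sphere_orthogonal (O : 'M[R]_n) (f : borel_cV R n -> \bar R) :
  O^T *m O = 1%:M -> measurable_fun [set: borel_cV R n] f ->
  mu.-integrable S (f \o mulmx O) ->
  (\int[mu]_(x in S) f (mulmx O x) = \int[mu]_(x in S) f x)%E.
Proof.
move=> OO mf intfO.
have mO := @mulmx_measurable R n O.
transitivity (\int[pushforward mu
    (mulmx O : borel_cV R n -> borel_cV R n)]_(x in S) f x)%E.
  rewrite (integral_pushforward mO mf)//.
  - by rewrite unit_sphere_orthogonal.
  - by rewrite unit_sphere_orthogonal.
  - exact: unit_sphere_measurable.
by apply: eq_measure_integral => // A mA _; exact: distribution_orthogonal.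
Qed.

Let quad i j (x : borel_cV R n) : \bar R :=
  ((x : 'cV[R]_n) i 0 * (x : 'cV[R]_n) j 0)%:E.

Let measurable_quad i j : measurable_fun [set: borel_cV R n] (quad i j).
Proof.
apply/measurable_EFinP; apply: measurable_funM; exact: coord_measurable.
Qed.

Let integrable_quad i j : mu.-integrable S (quad i j).
Proof.
apply: measurable_bounded_integrable.
- exact: unit_sphere_measurable.
- by rewrite /= distribution_sphere ltry.
- apply: measurable_funTS; apply: measurable_funM; exact: coord_measurable.
- exists 1; split; first exact: num_real.
  move=> M M1 x Sx /=; apply: le_trans (ltW M1).
  by rewrite normrM mulr_ile1// unit_sphere_coord_le1.
Qed.

Let quad_swap i j :
  (\int[mu]_(x in S) quad i i x = \int[mu]_(x in S) quad j j x)%E.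
Proof.
pose O : 'M[R]_n := tperm_mx i j.
have Oe k (x : 'cV[R]_n) : (O *m x) k 0 = x (tperm i j k) 0.
  by rewrite -row_permE mxE.
have OO : O^T *m O = 1%:M by rewrite tr_tperm_mx -perm_mxM tperm2 perm_mx1.
have E : quad i i \o mulmx O = quad j j.
  by apply/funext => x; rewrite /quad/= !Oe tpermL.
rewrite -(integral_sphere_orthogonal OO)//; last by rewrite E.
by apply: eq_integral => x _; rewrite -[LHS]/((quad i i \o mulmx O) x) E.
Qed.

Let quad_offdiag i j : i != j -> (\int[mu]_(x in S) quad i j x = 0)%E.
Proof.
move=> ij.
(* The reflection negating coordinate i alone; since j differs from i, it negates x_i x_j. *)
pose O : 'M[R]_n := diag_mx (\row_k (-1) ^+ (k == i)).
have Oe k (x : 'cV[R]_n) : (O *m x) k 0 = (-1) ^+ (k == i) * x k 0.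
  by rewrite mul_diag_mx !mxE.
have OO : O^T *m O = 1%:M.
  rewrite tr_diag_mx mulmx_diag -diag_const_mx; congr diag_mx.
  by apply/rowP => k; rewrite !mxE -expr2 sqrr_sign.
have E : quad i j \o mulmx O = (fun x => (-1)%:E * quad i j x)%E.
  apply/funext => x; rewrite /quad/= !Oe eqxx (eq_sym j) (negbTE ij) expr0.
  by rewrite -EFinM; congr EFin; ring.
have := integral_sphere_orthogonal OO (measurable_quad i j).
under eq_integral do rewrite -[quad i j _]/((quad i j \o mulmx O) _) E.
rewrite E integralZl//; last exact: unit_sphere_measurable.
move=> /(_ (integrableZl unit_sphere_measurable _ (integrable_quad i j))).
(* Invariance says that the integral equals its own negative; finiteness makes this an equation
   between reals. *)
have : (\int[mu]_(x in S) quad i j x)%E \is a fin_num.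
  by apply: integrable_fin_num => //; exact: unit_sphere_measurable.
case: (\int[mu]_(x in S) quad i j x)%E => // r _ [] rr.
by congr EFin; lra.
Qed.

Let quad_diag i : (\int[mu]_(x in S) quad i i x = (n%:R^-1)%:E)%E.
Proof.
have : (\sum_j \int[mu]_(x in S) quad j j x = 1)%E.
  rewrite -integral_sum//; last exact: unit_sphere_measurable.
  (* The 1 becomes the integral of the constant 1 over [S], to be compared pointwise with the sum of
     squared coordinates. *)
  rewrite -distribution_sphere -[RHS]mul1e -integral_cst; last first.
    exact: unit_sphere_measurable.
  apply: eq_integral => x; rewrite inE => /unit_sphereP x1.
  by rewrite /quad sumEFin; congr EFin.
under eq_bigr => j _ do rewrite (quad_swap j i).
have : (\int[mu]_(x in S) quad i i x)%E \is a fin_num.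
  by apply: integrable_fin_num => //; exact: unit_sphere_measurable.
case: (\int[mu]_(x in S) quad i i x)%E => // r _.
rewrite sumEFin sumr_const card_ord => -[] rn1.
(* The existence of the index i forces n > 0. *)
have n0 : n%:R != 0 :> R.
  by rewrite pnatr_eq0 -lt0n (leq_ltn_trans _ (ltn_ord i)).
by rewrite -[r](mulfK n0) mulr_natr rn1 mul1r.
Qed.

Lemma expectation_sphere m (A : 'M[R]_(m, n)) :
  ('E_Pr[fun w => (frobenius (A *m (X w : 'cV[R]_n)) ^+ 2)%R] =
   (n%:R^-1 * frobenius A ^+ 2)%:E)%E.
Proof.
pose f (x : borel_cV R n) := (frobenius (A *m (x : 'cV[R]_n)) ^+ 2)%:E.
have mf : measurable_fun [set: borel_cV R n] f.
  by apply/measurable_EFinP; exact: frobenius_measurable.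
have mS := @unit_sphere_measurable R n.
have f0 x : (0 <= f x)%E by rewrite lee_fin sqr_ge0.
rewrite unlock -[LHS]/(\int[Pr]_w (f \o X) w)%E -ge0_integral_distribution//.
(* Discarding the null complement of the sphere leaves a domain on which the products of coordinates
   are bounded, so the expanded square can be integrated term by term. *)
rewrite (@ge0_negligible_integral _ _ _ mu setT (~` S))//; first last.
- exact: distribution_sphereC.
- exact: measurableC.
rewrite setTD setCK.
transitivity (\int[mu]_(x in S)
    \sum_k \sum_i \sum_j (A k i * A k j)%:E * quad i j x)%E.
  apply: eq_integral => x _; rewrite /f frobenius_sqr_cV -sumEFin.
  apply: eq_bigr => k _; rewrite mxE expr2 mulr_suml -sumEFin.
  apply: eq_bigr => i _; rewrite mulr_sumr -sumEFin.
  by apply: eq_bigr => j _; rewrite /quad -EFinM; congr EFin; ring.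
have int0 k i j : mu.-integrable S (fun x => (A k i * A k j)%:E * quad i j x)%E.
  exact: integrableZl.
rewrite integral_sum//; last first.
  by move=> k; do 2 (apply: integrable_sum => // ? _).
rewrite frobenius_sqr mulr_sumr -sumEFin; apply: eq_bigr => k _.
rewrite integral_sum//; last by move=> i; apply: integrable_sum.
rewrite mulr_sumr -sumEFin; apply: eq_bigr => i _.
(* For fixed k and i only the term j = i survives, contributing A_ki^2 / n. *)
rewrite integral_sum// (bigD1 i)//= big1 ?adde0; last first.
  by move=> j ji; rewrite integralZl// quad_offdiag ?mule0// eq_sym.
by rewrite integralZl// quad_diag -EFinM -expr2 mulrC.
Qed.

End uniform_sphere.

Theorem proposition2 (R : realType) (n : nat) (hn : (1 <= n)%N) (Q : 'M[R]_n)
    (d : measure_display) (Omega : measurableType d)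
    (Pr : probability Omega R) (X : {RV Pr >-> borel_cV R n})
    (hX : uniform_on_sphere X) :
  argmin (perm_matrices R n) (fun P => frobenius (Q - P) ^+ 2) =
  argmin (perm_matrices R n)
    (fun P => ('E_Pr[fun w => (frobenius (Q *m X w - P *m X w) ^+ 2)%R])%E).
Proof.
have EE (P : 'M[R]_n) :
    ('E_Pr[fun w => (frobenius (Q *m X w - P *m X w) ^+ 2)%R] =
     (n%:R^-1 * frobenius (Q - P) ^+ 2)%:E)%E.
  rewrite -(expectation_sphere hX); congr expectation; apply/funext => w.
  by rewrite mulmxBl.
(* Positivity of the factor 1/n lets it be cancelled from both sides of every comparison of
   values. *)
have n0 : 0 < n%:R^-1 :> R by rewrite invr_gt0 ltr0n.
apply/seteqP; split=> P [DP Pmin]; split=> // P' /Pmin;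
  by rewrite !EE lee_fin ler_pM2l.
Qed.
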